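(* Let $\mathbb{F}$ be a finite field, let $a,\alpha$ be positive integers ($\alpha$ not too small), $n=a\alpha$, and let $\mathcal{C}\in\mathbb{F}^{n\times n}$ be a well-conditioned square matrix, subdivided into $a\times a$ square blocks of equal size $\alpha\times\alpha$. Then the (weighted) length of a critical path in the dependency graph described in the context is $\alpha^3(3a-2)$, and hence the average degree of concurrency of the parallel Gauss algorithm described in the context (called ''the Chief'') is $\frac{1}{3}a^{2}$.
   Context: Well-conditioned: for every $j=1,\dots,a$ the top-left square submatrix of $\mathcal{C}$ of size $j\alpha\times j\alpha$ has full rank. Cost assumptions: multiplying an $x\times y$ matrix by a $y\times z$ matrix, possibly followed by a matrix addition, costs $xyz$; echelonising an $x\times y$ matrix of rank $r$ costs $xyr$; tasks that only copy, extract, interleave or do bookkeeping are assigned cost $0$. The cost of the sequential Gauss algorithm (with transformation matrix) applied to an $n\times n$ matrix is taken to be $n^3$. A critical path in a task dependency graph is a longest directed path between any pair of start node and finish node, its length being weighted by the cost of the nodes along the path. The average degree of concurrency of the parallel algorithm is the cost of the sequential Gauss algorithm (with transformation matrix) divided by the weighted length of a critical path. The parallel Gauss algorithm (the Chief) computes the (negative) reduced row echelon form of $\mathcal{C}$ together with the transformation matrix. Ignoring tasks of cost $0$, it consists of a first step (bringing the matrix to block upper triangular form), a cost-$0$ intermediate step, and a final back-cleaning step in which, for $k$ from $a$ down to $1$ and $j$ from $1$ to $k-1$, suitable multiples of block row $k$ are added to block row $j$, both for the echelon form and for the transformation matrix. The first step involves two kinds of tasks: $\downarrow(i,j)$ (ClearDown,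 for $1\le i,j\le a$), which uses the pivot rows already collected for block column $j$ to reduce the current block in position $(i,j)$, echelonises the result and merges the new pivots into the collection for block column $j$; and $\rightarrow(i,j,k)$ (UpdateRow, for $1\le i\le a$, $1\le j<k\le a$), which performs the row operations found by $\downarrow(i,j)$ on the current block in position $(i,k)$ and on the collected rows in block column $k$ whose pivots lie in block column $j$; rows whose pivots have been found are moved from the block to the collection. Dependency graph: its nodes are the tasks $\downarrow(i,j)$ and $\rightarrow(i,j,k)$ of the first step, with directed edges, whenever both tasks exist: $\downarrow(i-1,j)$ to $\downarrow(i,j)$; $\rightarrow(i,j-1,j)$ to $\downarrow(i,j)$; $\downarrow(i,j)$ to $\rightarrow(i,j,k)$; $\rightarrow(i-1,j,k)$ to $\rightarrow(i,j,k)$; $\rightarrow(i,j-1,k)$ to $\rightarrow(i,j,k)$. It decomposes into layers according to the value of $i+j\in\{2,\dots,2a\}$. Task costs in the well-conditioned case: with a proper implementation, the cost of $\downarrow(i,j)$ is $\alpha^3$ if $i=j$ and $0$ otherwise, and the cost of $\rightarrow(i,j,k)$ is $\alpha^3$.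
   Formalization: The average degree of concurrency is literally a^3/(3a-2), never exactly a^2/3 (for a=1 it is 1, not 1/3); the formal theorem states this exact value together with its asymptotic equality to a^2/3 as a grows, uniformly in the field, alpha and the matrix. *)

(* Defs.v *)
From mathcomp Require Import all_boot all_order all_algebra.

Set Implicit Arguments.
Unset Strict Implicit.
Unset Printing Implicit Defensive.

Import Order.TTheory GRing.Theory Num.Theory.

Definition well_conditioned (F : fieldType) (a alpha : nat)
    (C : 'M[F]_(a * alpha)) : Prop :=
  forall (j : nat) (hj : j <= a), 0 < j ->
    let f := widen_ord (leq_mul hj (leqnn alpha)) in
    \rank (mxsub f f C) = (j * alpha)%N.

(* Block indices are 1-based; [is_task a] carves out the tasks that occur for *)
(* an a x a block subdivision.                                                *)
Inductive task : Type :=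
  | ClearDown of nat & nat
  | UpdateRow of nat & nat & nat.

Definition is_task (a : nat) (t : task) : bool :=
  match t with
  | ClearDown i j => (1 <= i <= a) && (1 <= j <= a)
  | UpdateRow i j k => [&& 1 <= i <= a, 1 <= j, j < k & k <= a]
  end.

(* [depends s t]: there is an edge from s to t.                               *)
Definition depends (s t : task) : bool :=
  match s, t with
  | ClearDown i' j', ClearDown i j => (i == i'.+1) && (j == j')
  | UpdateRow i' j' k', ClearDown i j => [&& i == i', j == j'.+1 & j == k']
  | ClearDown i' j', UpdateRow i j k => (i == i') && (j == j')
  | UpdateRow i' j' k', UpdateRow i j k =>
      (k == k') &&
      ((i == i'.+1) && (j == j') || (i == i') && (j == j'.+1))
  end.

Definition edge (a : nat) (s t : task) : bool :=
  [&& is_task a s, is_task a t & depends s t].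

Definition start_node (a : nat) (t : task) : Prop :=
  is_task a t /\ forall s, ~~ edge a s t.

Definition finish_node (a : nat) (t : task) : Prop :=
  is_task a t /\ forall u, ~~ edge a t u.

(* As in [path], a directed path is given by its first node s and the         *)
(* sequence p of the following ones.                                          *)
Definition start_finish_path (a : nat) (s : task) (p : seq task) : Prop :=
  [/\ start_node a s, path (edge a) s p & finish_node a (last s p)].

Definition weighted_length (c : task -> nat) (s : task) (p : seq task) : nat :=
  \sum_(t <- s :: p) c t.

Definition critical_path (a : nat) (c : task -> nat) (s : task) (p : seq task)
    : Prop :=
  start_finish_path a s p /\
  forall s' p', start_finish_path a s' p' ->
    weighted_length c s' p' <= weighted_length c s p.

(* Cost of each task when the algorithm is run on a given subdivided matrix.  *)
Definition cost_model : Type :=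
  forall (F : finFieldType) (a alpha : nat), 'M[F]_(a * alpha) -> task -> nat.

Definition well_conditioned_costs (a alpha : nat) (c : task -> nat) : Prop :=
  (forall i j, is_task a (ClearDown i j) ->
     c (ClearDown i j) = if i == j then (alpha ^ 3)%N else 0%N) /\
  (forall i j k, is_task a (UpdateRow i j k) ->
     c (UpdateRow i j k) = (alpha ^ 3)%N).

(* Cost of sequential Gauss, with transformation matrix, on an n x n matrix.  *)
Definition sequential_cost (n : nat) : nat := n ^ 3.

Definition average_concurrency (n : nat) (c : task -> nat) (s : task)
    (p : seq task) : rat :=
  ((sequential_cost n)%:R / (weighted_length c s p)%:R)%R.

(* Main.v *)
(** Split a path into layers of constant [i + j].  Within a layer it visits at
    most one ClearDown, followed by at most one UpdateRow, and a ClearDown has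
    nonzero cost only on the diagonal, hence only in even layers.  The layers
    2, ..., 2a - 1 thus contribute at most 2a - 2 UpdateRows and the even layers
    2, ..., 2a at most a diagonal ClearDowns.  The path that moves from
    ClearDown(i,i) to ClearDown(i+1,i+1) through UpdateRow(i,i,i+1) and
    UpdateRow(i+1,i,i+1) attains both bounds. *)

Require Import Defs.
From mathcomp Require Import all_boot all_order all_algebra.
From mathcomp Require Import zify ring lra.

Set Implicit Arguments.
Unset Strict Implicit.
Unset Printing Implicit Defensive.

Import Order.TTheory GRing.Theory Num.Theory.

(* An upper bound, in units of [alpha ^ 3], for the weight of the directed paths *)
(* ending in [t]: one UpdateRow per earlier layer, one diagonal ClearDown per    *)
(* earlier even layer, and the share of the layer of [t] itself.                 *)
Definition depth (t : task) : nat :=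
  match t with
  | ClearDown i j => (i + j - 2) + (i + j).-1./2 + (i == j)
  | UpdateRow i j _ => (i + j).-1 + (i + j)./2
  end.

Definition unit_cost (t : task) : nat :=
  if t is ClearDown i j then i == j else 1.

Lemma well_conditioned_costsE (a alpha : nat) (c : task -> nat) (t : task) :
  well_conditioned_costs a alpha c -> is_task a t ->
  c t = alpha ^ 3 * unit_cost t.
Proof.
case=> cD cU; case: t => [i j | i j k] tT /=; last by rewrite cU // muln1.
by rewrite cD //; case: eqP; rewrite ?muln1 ?muln0.
Qed.

Lemma unit_cost_le_depth (a : nat) (t : task) :
  is_task a t -> unit_cost t <= depth t.
Proof. by case: t => [i j | i j k] /=; lia. Qed.

(** Only an edge from a ClearDown to an UpdateRow keeps [i + j]; every other edge raises it by one.
    The UpdateRow skipped by an edge between two ClearDowns is slack. *)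
Lemma depth_edge (a : nat) (s t : task) :
  edge a s t -> depth s + unit_cost t <= depth t.
Proof. by case: s t => [i j | i j k] [i' j' | i' j' k']; rewrite /edge /=; lia. Qed.

(** As [j < k <= a] for an UpdateRow, the layer [i + j = 2 * a] holds only [ClearDown a a], where
    the bound is attained. *)
Lemma depth_le (a : nat) (t : task) : is_task a t -> depth t <= 3 * a - 2.
Proof. by case: t => [i j | i j k] /=; lia. Qed.

Lemma last_is_task (a : nat) (s : task) (p : seq task) :
  is_task a s -> path (edge a) s p -> is_task a (last s p).
Proof. by elim: p s => //= t p IHp s _ /andP[/and3P[_ tT _]]; apply: IHp. Qed.

Lemma weighted_length_rcons (c : task -> nat) (s : task) (p : seq task)
    (t : task) :
  weighted_length c s (rcons p t) = weighted_length c s p + c t.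
Proof. by rewrite /weighted_length -rcons_cons -cats1 big_cat big_seq1. Qed.

Section CriticalPath.

Variables (a alpha : nat) (c : task -> nat).
Hypothesis c_wc : well_conditioned_costs a alpha c.

(** [depth] is a potential: each appended task raises it by at least its unit cost. *)
Lemma weighted_length_le_depth (s : task) (p : seq task) :
  is_task a s -> path (edge a) s p ->
  weighted_length c s p <= alpha ^ 3 * depth (last s p).
Proof.
move=> sT; elim/last_ind: p => [|p t IHp].
  rewrite /weighted_length big_seq1 (well_conditioned_costsE c_wc sT) => _.
  by rewrite leq_mul2l (unit_cost_le_depth sT) orbT.
rewrite rcons_path last_rcons weighted_length_rcons => /andP[/IHp{}IHp st].
have /and3P[_ tT _] := st.
rewrite (well_conditioned_costsE c_wc tT).
apply: leq_trans (leq_add IHp (leqnn _)) _.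
by rewrite -mulnDr leq_mul2l (depth_edge st) orbT.
Qed.

Lemma weighted_length_le (s : task) (p : seq task) :
  start_finish_path a s p -> weighted_length c s p <= alpha ^ 3 * (3 * a - 2).
Proof.
move=> [[sT _] sp _]; apply: leq_trans (weighted_length_le_depth sT sp) _.
by rewrite leq_mul2l (depth_le (last_is_task sT sp)) orbT.
Qed.

Lemma diagonal_path (m : nat) : m < a ->
  exists p, [/\ path (edge a) (ClearDown 1 1) p,
    last (ClearDown 1 1) p = ClearDown m.+1 m.+1 &
    weighted_length c (ClearDown 1 1) p = alpha ^ 3 * (3 * m + 1)].
Proof.
elim: m => [|m IHm] lt_ma.
  exists [::]; split=> //; rewrite /weighted_length big_seq1.
  by rewrite (well_conditioned_costsE c_wc) //= lt_ma.
have [p [p_path p_last p_len]] := IHm (ltnW lt_ma).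
exists (rcons (rcons (rcons p (UpdateRow m.+1 m.+1 m.+2))
                 (UpdateRow m.+2 m.+1 m.+2)) (ClearDown m.+2 m.+2)).
rewrite !rcons_path !last_rcons p_path p_last; split=> //.
  by rewrite /edge /=; lia.
rewrite !weighted_length_rcons p_len.
by rewrite !(well_conditioned_costsE c_wc) //= ?eqxx; lia.
Qed.

Lemma start_finish_path_weight : 0 < a ->
  exists s p, start_finish_path a s p /\
    weighted_length c s p = alpha ^ 3 * (3 * a - 2).
Proof.
move=> a_gt0; have [|p [p_path p_last p_len]] := @diagonal_path a.-1.
  by rewrite prednK.
exists (ClearDown 1 1), p; split; last by rewrite p_len; congr (_ * _); lia.
split=> //; rewrite ?p_last; split; rewrite /= ?prednK ?a_gt0 ?leqnn //.
  (* A predecessor of [ClearDown 1 1] would need an index 0, a successor of [ClearDown a a] a row or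
     a [k] beyond [a]. *)
  by case=> [i j | i j k]; rewrite /edge /=; lia.
by case=> [i j | i j k]; rewrite /edge /=; lia.
Qed.

Lemma critical_path_exists : 0 < a -> exists s p, critical_path a c s p.
Proof.
move=> /start_finish_path_weight[s [p [sp_path sp_len]]].
exists s, p; split=> // s' p' /weighted_length_le.
by rewrite sp_len.
Qed.

Lemma critical_path_weight (s : task) (p : seq task) : 0 < a ->
  critical_path a c s p -> weighted_length c s p = alpha ^ 3 * (3 * a - 2).
Proof.
move=> /start_finish_path_weight[s' [p' [path' len']]] [sp_path sp_max].
by apply/eqP; rewrite eqn_leq weighted_length_le // -len' sp_max.
Qed.

Lemma critical_path_concurrency (s : task) (p : seq task) :
  0 < a -> 0 < alpha -> critical_path a c s p ->
  average_concurrency (a * alpha) c s p = (a%:R ^+ 3 / (3 * a%:R - 2))%R.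
Proof.
move=> a_gt0 alpha_gt0 /(critical_path_weight a_gt0) len_sp.
rewrite /average_concurrency /sequential_cost len_sp expnMn mulnC.
have alpha3_neq0 : ((alpha ^ 3)%:R != 0 :> rat)%R.
  by rewrite pnatr_eq0 -lt0n expn_gt0 alpha_gt0.
(* The subtraction is not truncated, since [0 < a]. *)
have natr_den : ((3 * a - 2)%:R = 3 * a%:R - 2 :> rat)%R.
  by rewrite natrB ?natrM //; lia.
by rewrite -natrX natrM [(_ * (_ - _))%:R%R]natrM natr_den -mulf_div divff ?mul1r.
Qed.

End CriticalPath.

(** The relative error is exactly [2 / (3 * x - 2)], at most [2 / x] because [x <= 3 * x - 2] for
    [1 <= x]. *)
Lemma concurrency_asymptotic (R : realFieldType) (eps x : R) :
  (0 < eps -> 1 <= x -> 2 / eps <= x ->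
   `| x ^+ 3 / (3 * x - 2) - 3^-1 * x ^+ 2 | <= eps * (3^-1 * x ^+ 2))%R.
Proof.
move=> eps_gt0 x_ge1; rewrite ler_pdivrMr // => le_x.
have den_gt0 : (0 < 3 * x - 2)%R by lra.
have -> : (x ^+ 3 / (3 * x - 2) - 3^-1 * x ^+ 2
           = 2 / (3 * x - 2) * (3^-1 * x ^+ 2))%R.
  by field; rewrite lt0r_neq0.
have sq_ge0 : (0 <= 3^-1 * x ^+ 2)%R by rewrite mulr_ge0 ?sqr_ge0 ?invr_ge0.
rewrite ger0_norm; last by rewrite mulr_ge0 // divr_ge0 // ltW.
by rewrite ler_wpM2r // ler_pdivrMr //; nra.
Qed.

(** The exact quotient only has [a^2 / 3] as leading term, so that value is claimed up to relative
    error [eps] for large [a], uniformly in the field, [alpha] and the matrix. [alpha0] expresses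
    that [alpha] is not too small. *)
Theorem theorem5p4 (cost : cost_model) (alpha0 : nat)
  (hcost : forall (F : finFieldType) (a alpha : nat) (C : 'M[F]_(a * alpha)),
     0 < a -> 0 < alpha -> alpha0 <= alpha -> well_conditioned C ->
     well_conditioned_costs a alpha (cost F a alpha C)) :
  (forall (F : finFieldType) (a alpha : nat) (C : 'M[F]_(a * alpha)),
     0 < a -> 0 < alpha -> alpha0 <= alpha -> well_conditioned C ->
     (exists s p, critical_path a (cost F a alpha C) s p) /\
     (forall s p, critical_path a (cost F a alpha C) s p ->
        weighted_length (cost F a alpha C) s p = (alpha ^ 3 * (3 * a - 2))%N /\
        average_concurrency (a * alpha) (cost F a alpha C) s p
          = (a%:R ^+ 3 / (3 * a%:R - 2))%R))
  /\
  (forall eps : rat, (0 < eps)%R ->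
     exists a0 : nat,
     forall (F : finFieldType) (a alpha : nat) (C : 'M[F]_(a * alpha)),
       a0 <= a -> 0 < a -> 0 < alpha -> alpha0 <= alpha -> well_conditioned C ->
       forall s p, critical_path a (cost F a alpha C) s p ->
         (`| average_concurrency (a * alpha) (cost F a alpha C) s p
             - 3^-1 * a%:R ^+ 2 | <= eps * (3^-1 * a%:R ^+ 2))%R).
Proof.
split=> [F a alpha C a_gt0 alpha_gt0 le_alpha C_wc | eps eps_gt0].
  have c_wc := hcost F a alpha C a_gt0 alpha_gt0 le_alpha C_wc.
  split=> [|s p sp_crit]; first exact: (critical_path_exists c_wc a_gt0).
  split; first exact: (critical_path_weight c_wc a_gt0 sp_crit).
  exact: (critical_path_concurrency c_wc a_gt0 alpha_gt0 sp_crit).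
exists (Num.bound (2 / eps)%R) => F a alpha C le_a a_gt0 alpha_gt0 le_alpha C_wc.
move=> s p sp_crit; have c_wc := hcost F a alpha C a_gt0 alpha_gt0 le_alpha C_wc.
rewrite (critical_path_concurrency c_wc a_gt0 alpha_gt0 sp_crit).
apply: concurrency_asymptotic; rewrite ?ler1n //.
have eps2_ge0 : (0 <= 2 / eps)%R by rewrite divr_ge0 // ltW.
by apply: le_trans (ltW (archi_boundP eps2_ge0)) _; rewrite ler_nat.
Qed.
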